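(* Let $k$ be a positive integer, let \[ R(n)=a_kn^k+a_{k-1}n^{k-1}+\ldots+a_0 \] be a polynomial with integer coefficients, $a_k\neq 0$. Then there is a constant $C(R)>0$, depending only on $R$, such that if $s$ is a positive integer and $x$ is a real number with $x\geq 1$, then \[ \sum_{\substack{-x\leq n\leq x\\ R(n)\neq 0}}\left(\frac{|R(n)|}{\varphi(|R(n)|)}\right)^{s}\leq (C(R))^{s}s!\,x, \] where the sum is over integers $n$.
   Context: $\varphi$ is Euler's totient function. Empty sums are $0$. *)

(* Defs.v *)
From HB Require Import structures.
From mathcomp Require Import all_boot all_order all_algebra.
From mathcomp Require Import boolp classical_sets functions cardinality fsbigop.
From mathcomp Require Import reals.

Set Implicit Arguments.
Unset Strict Implicit.
Unset Printing Implicit Defensive.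

Import Order.TTheory GRing.Theory Num.Theory.

Local Open Scope classical_set_scope.
Local Open Scope ring_scope.

(* [\sum_(n \in A) F n] is the sum over the support of [F] in [A] when that
   support is finite, and [0] otherwise. By this lemma, the second case does
   not occur when [A] is a set of integers of absolute value at most [x]. *)
Lemma finite_int_le (K : realType) (x : K) :
  finite_set [set n : int | - x <= n%:~R <= x].
Proof.
pose N := Num.bound `|x|.
apply: (@sub_finite_set _ _ [set i%:Z - N%:Z | i in `I_(N.*2.+1)]).
  move=> n /= /andP[lxn nx].
  have xN : x <= N%:R.
    by apply: le_trans (ler_norm x) (ltW (archi_boundP _)); exact: normr_ge0.
  have nN : n <= N%:Z by rewrite -(ler_int K); exact: le_trans nx xN.
  have Nn : 0 <= n + N%:Z.
    rewrite -(ler_int K) rmorphD /= -lerBlDr sub0r.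
    by apply: le_trans lxn; rewrite lerN2.
  exists (absz (n + N%:Z)); last by rewrite gez0_abs // addrK.
  by rewrite /= ltnS -lez_nat gez0_abs // -addnn PoszD lerD2r.
exact: finite_image (finite_II _).
Qed.

(* Main.v *)
Require Import Defs.
From mathcomp Require Import all_boot all_order all_algebra finmap.
From mathcomp Require Import boolp classical_sets functions cardinality fsbigop.
From mathcomp Require Import reals.
From mathcomp Require Import ring lra zify.

(** The quotient [m / phi(m)] is the product of the Euler factors [p / (p - 1)]
    over the primes [p] dividing [m]. Let [N] be the integer part of [x], let
    [y] be the integer with [y! <= N < (y + 1)!], and treat the primes above
    and below [y] separately.

    Large primes contribute a bounded factor pointwise. If [|n| <= N] then
    [|R(n)| <= A N^k], which is at most [(y + 1)^(D y)] for a constant [D] since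
    [N <= (y + 1)^(y + 1)]. So a nonzero [R(n)] has at most [D y] prime divisors
    exceeding [y], each with Euler factor at most [1 + 1/y], and
    [(1 + 1/y)^(D y) <= 4^D] (lemma [prod_large_euler_factor_le]).

    Small primes are handled on average. What remains depends on [n] modulo
    [P], the product of the primes up to [y], and [P <= y! <= N]; hence the sum
    over [|n| <= N] is at most [4N] times the average over the residues
    modulo [P]. By the Chinese remainder theorem this average is the product
    over [p <= y] of [1 + (rho(p) / p) ((p / (p - 1))^s - 1)], where [rho(p)],
    the number of roots of [R] modulo [p], is at most [p] and at most a constant
    [B]. For [p <= 2s] the local factor is at most [(p / (p - 1))^s], and the
    product of these telescopes to at most [(2s)^s]; this is where [s!] comes
    from, as [s^s <= 4^s s!]. For [p > 2s] it is at most [1 + 2Bs / p^2], hence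
    at most [(1 - p^-2)^(-2Bs)], and the product of these is at most
    [4^(Bs)] (lemma [sum_small_primes_le]). *)

Set Implicit Arguments.
Unset Strict Implicit.
Unset Printing Implicit Defensive.

Import Order.TTheory GRing.Theory Num.Theory.

Local Open Scope classical_set_scope.
Local Open Scope ring_scope.

(** * Powers and factorials *)

Section Elementary.
Variable F : realFieldType.

Lemma bernoulli (t : F) n : -1 <= t -> 1 + n%:R * t <= (1 + t) ^+ n.
Proof.
move=> t1; elim: n => [|n IH]; first by rewrite mul0r addr0 expr0.
have h : (1 + n%:R * t) * (1 + t) <= (1 + t) ^+ n.+1.
  by rewrite exprSr ler_wpM2r //; lra.
apply: le_trans h; rewrite -natr1.
have : 0 <= n%:R * t ^+ 2 :> F by rewrite mulr_ge0 // sqr_ge0.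
by move=> ?; nra.
Qed.

(** Bernoulli's inequality gives [(1 - 1/(n+1))^h >= 1/2] for [h] about [n/2];
    squaring it bounds the inverse of the left-hand side below by [1/4]. *)
Lemma one_plus_inv_exp_le4 n : (0 < n)%N -> (n.+1%:R / n%:R) ^+ n <= 4 :> F.
Proof.
move=> n0; set r : F := n%:R / n.+1%:R.
have n1 : 0 < n.+1%:R :> F by rewrite ltr0n.
have r0 : 0 < r by rewrite divr_gt0 // ltr0n.
have rE : r = 1 + - n.+1%:R^-1.
  by rewrite /r -[X in X / _](addrK 1) natr1 mulrBl divff ?gt_eqF // mul1r.
have r1 : r <= 1 by rewrite rE gerDl oppr_le0 invr_ge0 ltW.
rewrite -[_ / _]invf_div -/r exprVn -[leRHS]invrK.
rewrite lef_pV2 ?posrE ?exprn_gt0 ?invr_gt0 //.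
have hb : 2^-1 <= r ^+ uphalf n.
  rewrite rE; apply: le_trans (bernoulli _ _); last first.
    by rewrite lerN2 invf_le1 // ler1n.
  have : (uphalf n)%:R * n.+1%:R^-1 <= 2^-1 :> F.
    rewrite ler_pdivrMr // mulrC ler_pdivlMr // -natrM ler_nat; lia.
  by rewrite mulrN; move: (_ * _) => z; lra.
have -> : 4^-1 = 2^-1 * 2^-1 :> F by field.
apply: (@le_trans _ _ (r ^+ uphalf n * r ^+ uphalf n)).
  by apply: ler_pM => //; rewrite invr_ge0.
rewrite -exprD; apply: ler_wiXn2l => //; [exact: ltW|lia].
Qed.

(** Passing from [s] to [s + 1] multiplies the left-hand side by
    [(s + 1) (1 + 1/s)^s]. *)
Lemma exp_self_le_fact s : s%:R ^+ s <= 4 ^+ s * s`!%:R :> F.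
Proof.
elim: s => [|[|s] IH]; first by rewrite !expr0 fact0 mulr1.
  by rewrite expr1n expr1 factS fact0 mulr1; lra.
have s0 : s.+1%:R != 0 :> F by rewrite pnatr_eq0.
have -> : s.+2%:R ^+ s.+2
    = s.+2%:R * ((s.+2%:R / s.+1%:R) ^+ s.+1 * s.+1%:R ^+ s.+1) :> F.
  by rewrite expr_div_n divfK ?expf_neq0 // -exprS.
rewrite [4 ^+ _]exprS factS natrM.
have := @one_plus_inv_exp_le4 s.+1 isT => h.
have -> : 4 * 4 ^+ s.+1 * (s.+2%:R * s.+1`!%:R)
  = s.+2%:R * (4 * (4 ^+ s.+1 * s.+1`!%:R)) :> F by ring.
rewrite ler_wpM2l //; apply: ler_pM => //.
  by rewrite exprn_ge0 // divr_ge0.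
by rewrite exprn_ge0.
Qed.

(** * Sums and products over subsequences *)

(** The terms of [t] left over by [r] contribute a factor at least [1]. *)
Lemma ler_prod_sub (I : eqType) (r t : seq I) (f : I -> F) :
  uniq r -> {subset r <= t} -> {in t, forall i, 1 <= f i} ->
  \prod_(i <- r) f i <= \prod_(i <- t) f i.
Proof.
have prod_ge1 (q : seq I) : {in q, forall i, 1 <= f i} ->
    1 <= \prod_(i <- q) f i.
  move=> f1; rewrite big_seq; elim/big_ind: _ => // x y x1 y1.
  by rewrite -[1]mulr1 ler_pM.
elim: r t => [|a r IH] t /=.
  by move=> _ _ f1; rewrite big_nil; exact: prod_ge1.
move=> /andP[ar ur] st f1.
have ta := st a (mem_head _ _).
rewrite (big_rem a ta) /= big_cons ler_wpM2l ?(le_trans ler01 (f1 _ ta)) //.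
apply: IH => // [b br|b /mem_rem]; last exact: f1.
have : b \in t by apply: st; rewrite inE br orbT.
rewrite (perm_mem (perm_to_rem ta)) inE => /orP[/eqP ba|//].
by rewrite -ba br in ar.
Qed.

Lemma ler_sum_sub (I : eqType) (r t : seq I) (f : I -> F) :
  uniq r -> {subset r <= t} -> (forall i, 0 <= f i) ->
  \sum_(i <- r) f i <= \sum_(i <- t) f i.
Proof.
elim: r t => [|a r IH] t /=; first by move=> _ _ f0; rewrite big_nil sumr_ge0.
move=> /andP[ar ur] st f0.
rewrite (big_rem a (st a _)) ?mem_head //= big_cons lerD2l.
apply: IH => // b br.
have : b \in t by apply: st; rewrite inE br orbT.
rewrite (perm_mem (perm_to_rem (st a (mem_head _ _)))) inE => /orP[/eqP ba|//].
by rewrite -ba br in ar.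
Qed.

(** * Sums of periodic functions *)

Lemma sum_periodic_le (g : nat -> F) (P q L : nat) :
  (forall i, 0 <= g i) -> (forall i, g (i %% P)%N = g i) -> (L <= q * P)%N ->
  \sum_(0 <= i < L) g i <= q%:R * \sum_(0 <= i < P) g i.
Proof.
move=> g0 gP Lq.
apply: (@le_trans _ _ (\sum_(0 <= i < q * P) g i)).
  by rewrite [leRHS](@big_cat_nat _ _ _ L) //= lerDl sumr_ge0.
elim: q {Lq} => [|q IH]; first by rewrite mul0n big_geq ?mul0r.
rewrite mulSn addnC (@big_cat_nat _ _ _ (q * P)%N) //= ?leq_addr //.
rewrite -natr1 mulrDl mul1r; apply: lerD => //.
rewrite -{1}[(q * P)%N]add0n big_addn addKn.
rewrite le_eqVlt; apply/orP; left; apply/eqP/eq_bigr => i _.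
by rewrite -gP addnC modnMDl gP.
Qed.

(** Chinese remainder theorem: [i |-> (i %% M, i %% p)] is a bijection from the
    residues modulo [M * p] to the pairs of residues. Probabilistically,
    functions of independent residues are uncorrelated. *)
Lemma sum_mul_coprime (M p : nat) (f g : nat -> F) :
  (0 < M)%N -> (0 < p)%N -> coprime M p ->
  (forall i, f (i %% M)%N = f i) -> (forall i, g (i %% p)%N = g i) ->
  \sum_(0 <= i < M * p) f i * g i
  = (\sum_(0 <= i < M) f i) * (\sum_(0 <= i < p) g i).
Proof.
move=> M0 p0 cop fM gp.
rewrite !big_mkord big_distrlr /= pair_big /=.
pose h (i : 'I_(M * p)) : 'I_M * 'I_p :=
  (Ordinal (ltn_pmod i M0), Ordinal (ltn_pmod i p0)).
have hinj : injective h.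
  move=> i j [] eM ep; apply: val_inj => /=.
  have /eqP : i == j %[mod M * p] by rewrite chinese_remainder // eM ep !eqxx.
  by rewrite !modn_small.
rewrite (reindex h) /=.
  by apply: eq_bigr => i _; rewrite fM gp.
by apply/onW_bij/inj_card_bij => //; rewrite card_prod !card_ord.
Qed.

Lemma sum_prod_primes (ps : seq nat) (g : nat -> nat -> F) :
  uniq ps -> all prime ps ->
  (forall p i, prime p -> g p (i %% p)%N = g p i) ->
  \sum_(0 <= i < (\prod_(p <- ps) p)%N) \prod_(p <- ps) g p i
  = \prod_(p <- ps) \sum_(0 <= i < p) g p i.
Proof.
move=> + + gp; elim: ps => [|p ps IH] /=.
  by move=> _ _; rewrite !big_nil big_nat1 big_nil.
move=> /andP[pps ups] /andP[pp ppps]; rewrite !big_cons -IH //.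
rewrite -sum_mul_coprime ?(prime_gt0 pp) //.
- by apply: eq_bigr => i _; rewrite big_cons.
- by rewrite big_seq; apply: prodn_cond_gt0 => q /(allP ppps)/prime_gt0.
- rewrite big_seq; elim/big_ind: _ => [|x y cx cy|q qps].
  + exact: coprimen1.
  + by rewrite coprimeMr cx.
  + rewrite prime_coprime // dvdn_prime2 //; last exact: (allP ppps).
    by apply: contraNN pps => /eqP ->.
- by move=> i; exact: gp.
- move=> i; apply: eq_big_seq => q qps; have pq := allP ppps q qps.
  rewrite -[LHS]gp // -[RHS]gp //.
  by rewrite modn_dvdm // (big_rem q qps) /= dvdn_mulr.
Qed.

End Elementary.

(** * Values of an integer polynomial *)

(** Reduction modulo [p] turns divisibility of a value into a root over the
    field with [p] elements, which yields both the periodicity in [a] and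
    the bound on the number of such [a]. *)
Lemma dvdn_horner_rootE (R : {poly int}) (p : nat) (a : int) : prime p ->
  (p %| absz R.[a])%N = root (map_poly intr R : {poly 'F_p}) a%:~R.
Proof.
move=> pp; rewrite rootE horner_map /= -(dvdz_pcharf (pchar_Fp pp)).
by rewrite dvdzE.
Qed.

Lemma intr_Fp_inj (p : nat) (c : int) : prime p ->
  {in gtn p &, injective (fun i : nat => (i%:Z + c)%:~R : 'F_p)}.
Proof.
move=> pp i j; rewrite !inE => ip jp; rewrite !intrD => /addIr.
move/(congr1 val); rewrite /= -!pmulrn !val_Fp_nat // !modn_small //.
Qed.

Lemma intr_Fp_mod (p i : nat) (c : int) : prime p ->
  ((i %% p)%N%:Z + c)%:~R = (i%:Z + c)%:~R :> 'F_p.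
Proof. by move=> pp; rewrite !intrD -!pmulrn Fp_nat_mod. Qed.

(** When [p] divides the leading coefficient, the reduction of [R] may vanish
    identically, but then [p] is at most that coefficient in absolute value, and
    the count is at most [p]. Otherwise the reduction keeps its degree,
    which bounds its number of roots. *)
Lemma count_roots_mod_le (R : {poly int}) (p : nat) (c : int) :
  prime p -> R != 0 ->
  (count (fun i : nat => p %| absz R.[(i%:Z + c)%R])%N (index_iota 0 p)
    <= (size R).-1 + absz (lead_coef R))%N.
Proof.
move=> pp R0; have [pl|npl] := boolP (p %| absz (lead_coef R))%N.
  apply: leq_trans (count_size _ _) _; rewrite size_iota subn0.
  by rewrite (leq_trans (dvdn_leq _ pl)) ?leq_addl // absz_gt0 lead_coef_eq0.
have lR : (lead_coef R)%:~R != 0 :> 'F_p.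
  by rewrite -(dvdz_pcharf (pchar_Fp pp)) dvdzE.
set f : {poly 'F_p} := map_poly intr R.
have sf : size f = size R by rewrite /f size_map_poly_id0.
apply: leq_trans (leq_addr _ _); rewrite -size_filter.
rewrite -(size_map (fun i : nat => (i%:Z + c)%:~R : 'F_p)).
have sR : (0 < size R)%N by rewrite size_poly_gt0.
rewrite -ltnS prednK // -sf; apply: max_poly_roots.
- by rewrite -size_poly_gt0 sf.
- apply/allP => _ /mapP[i + ->]; rewrite mem_filter => /andP[+ _].
  by rewrite dvdn_horner_rootE.
- rewrite map_inj_in_uniq ?filter_uniq ?iota_uniq // => i j.
  rewrite !mem_filter !mem_index_iota => /andP[_ ip] /andP[_ jp].
  by apply: intr_Fp_inj => //; rewrite ?inE.
Qed.

Lemma horner_absz_le (R : {poly int}) (n : int) (N : nat) :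
  (absz n <= N)%N -> (0 < N)%N ->
  (absz R.[n] <= (\sum_(i < size R) absz (R`_i)%R) * N ^ (size R).-1)%N.
Proof.
move=> nN N0; rewrite horner_coef big_distrl /=.
apply: (@leq_trans (\sum_(i < size R) absz (R`_i * n ^+ i)%R)%N).
  elim/big_ind2: _ => // x1 x2 y1 y2 h1 h2.
  by apply: leq_trans (leq_add h1 h2); lia.
apply: leq_sum => i _; rewrite abszM leq_mul2l.
apply/orP; right; rewrite abszX; apply: (@leq_trans (N ^ i)%N).
  by case: (nat_of_ord i) => // j; rewrite leq_exp2r.
by rewrite leq_pexp2l // -ltnS (leq_trans (ltn_ord i)) // leqSpred.
Qed.

(** * Primes up to a bound, and factorials *)

Definition primes_upto (y : nat) := [seq p <- index_iota 2 y.+1 | prime p].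

Lemma mem_primes_upto y p : (p \in primes_upto y) = prime p && (p <= y)%N.
Proof.
rewrite mem_filter mem_index_iota ltnS; case: (boolP (prime p)) => //= pp.
by rewrite prime_gt1.
Qed.

Lemma prod_primes_upto_le y : (\prod_(p <- primes_upto y) p <= y`!)%N.
Proof.
rewrite big_filter big_mkcond /= fact_prod; case: y => [|y].
  by rewrite !big_geq.
rewrite [leqRHS]big_ltn // mul1n big_seq [leqRHS]big_seq.
apply: leq_prod => i; rewrite mem_index_iota => /andP[i2 _].
by case: ifP => // _; exact: ltnW.
Qed.

Lemma fact_le_exp n : (n`! <= n ^ n)%N.
Proof.
rewrite fact_prod -{3}[n]subn0 -subSS -prod_nat_const_nat.
rewrite big_seq [leqRHS]big_seq.
by apply: leq_prod => i; rewrite mem_index_iota ltnS => /andP[].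
Qed.

(** Cutting the primes at [y] with [y!] close to [N] replaces the usual cut near
    [log N]: the product of the primes up to [y] is at most [N] without any
    estimate on prime numbers, and [N] is still at most [(y + 1)^(y + 1)]. *)
Lemma fact_bracket N : (0 < N)%N ->
  exists2 y, (0 < y)%N & (y`! <= N < y.+1`!)%N.
Proof.
move=> N0; have ex : exists y, (y`! <= N)%N by exists 0%N.
have bd y : (y`! <= N)%N -> (y <= N)%N.
  by apply: leq_trans; exact: fact_geq.
case: (ex_maxnP ex bd) => y yN ymax; exists y; first exact: (ymax 1%N).
by rewrite yN ltnNge; apply/negP => /ymax; rewrite ltnn.
Qed.

(** * Euler factors *)

Section Totient.
Variable F : realFieldType.

Definition euler_factor (p : nat) : F := p%:R / p.-1%:R.

Lemma div_totientE (m : nat) : (0 < m)%N ->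
  m%:R / (totient m)%:R = \prod_(p <- primes m) euler_factor p.
Proof.
move=> m0; rewrite totientE // {1}(prod_prime_decomp m0).
rewrite prime_decompE big_map /=.
rewrite !natr_prod -prodf_div; apply: eq_big_seq => p; rewrite mem_primes.
move=> /and3P[pp _ pm].
have l0 : (0 < logn p m)%N by rewrite logn_gt0 mem_primes pp m0.
have b0 : (p ^ (logn p m).-1)%:R != 0 :> F.
  by rewrite pnatr_eq0 -lt0n expn_gt0 prime_gt0.
rewrite -{1}(prednK l0) expnSr !natrM /euler_factor [_ * p%:R]mulrC.
by rewrite -mulf_div divff // mulr1.
Qed.

Lemma euler_factor_ge1 p : (1 < p)%N -> 1 <= euler_factor p.
Proof.
move=> p1; rewrite /euler_factor ler_pdivlMr ?mul1r ?ler_nat ?leq_pred //.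
by rewrite ltr0n; lia.
Qed.

(** Extended to all integers from [2] to [M], the product of [p / (p - 1)]
    telescopes to [M]. *)
Lemma prod_euler_factor_le (ps : seq nat) (M : nat) : (0 < M)%N -> uniq ps ->
  {in ps, forall p, (1 < p)%N} ->
  \prod_(p <- ps | (p <= M)%N) euler_factor p <= M%:R.
Proof.
move=> M0 ups ps1; rewrite -big_filter.
apply: (@le_trans _ _ (\prod_(2 <= p < M.+1) euler_factor p)).
  apply: ler_prod_sub; first exact: filter_uniq.
    move=> p; rewrite mem_filter mem_index_iota => /andP[pM /ps1 ->].
    by rewrite ltnS.
  by move=> p; rewrite mem_index_iota => /andP[p1 _]; exact: euler_factor_ge1.
case: M M0 => // M _; case: M => [|M]; first by rewrite big_geq.
rewrite (@telescope_prodf_eq _ 2 M.+3 (fun p => p.-1%:R)) //=.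
- by rewrite divr1.
- by move=> p /andP[p2 _]; rewrite pnatr_eq0; lia.
Qed.

(** For [p > 1] this is [p^2 / (p^2 - 1)], the Euler factor of the Riemann zeta
    function at [2]. As a quotient of consecutive Euler factors, it has
    telescoping products. *)
Definition zeta2_factor (p : nat) : F := euler_factor p / euler_factor p.+1.

Lemma zeta2_factor_ge p : (1 < p)%N -> 1 + p%:R ^- 2 <= zeta2_factor p.
Proof.
case: p => // -[//|p] _; rewrite /zeta2_factor /euler_factor /=.
have : 0 <= p%:R :> F by [].
rewrite -!natr1; move: (p%:R) => x x0.
rewrite -subr_ge0.
have -> : (x + 1 + 1) / (x + 1) / ((x + 1 + 1 + 1) / (x + 1 + 1))
    - (1 + (x + 1 + 1) ^- 2)
  = ((x + 1) * (x + 1 + 1 + 1) * (x + 1 + 1) ^+ 2)^-1.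
  by field; rewrite ?gt_eqF //; lra.
by rewrite invr_ge0 !mulr_ge0 ?sqr_ge0 //; lra.
Qed.

Lemma zeta2_factor_ge1 p : (1 < p)%N -> 1 <= zeta2_factor p.
Proof.
move=> p1; apply: le_trans (zeta2_factor_ge p1).
by rewrite lerDl invr_ge0 exprn_ge0.
Qed.

(** Extended to all integers from [2] to [M], the product telescopes to
    [2 / (1 + 1/M)]. *)
Lemma prod_zeta2_factor_le (ps : seq nat) : uniq ps ->
  {in ps, forall p, (1 < p)%N} -> \prod_(p <- ps) zeta2_factor p <= 2.
Proof.
move=> ups ps1; pose M := (\max_(p <- ps) p).+2.
apply: (@le_trans _ _ (\prod_(2 <= p < M.+1) zeta2_factor p)).
  apply: ler_prod_sub => // p; rewrite mem_index_iota.
    move=> pps; rewrite ps1 //=.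
    have h := @leq_bigmax_seq _ ps predT id p pps isT.
    by rewrite /M ltnS !leqW.
  by move=> /andP[p1 _]; exact: zeta2_factor_ge1.
rewrite (@telescope_prodr_eq _ 2 M.+1 euler_factor) //.
  rewrite ler_pdivrMr; last by rewrite (lt_le_trans ltr01) // euler_factor_ge1.
  have := @euler_factor_ge1 M.+1 isT; rewrite /euler_factor /= divr1; lra.
move=> p /andP[p2 _]; rewrite unitfE gt_eqF // (lt_le_trans ltr01) //.
by rewrite euler_factor_ge1 // ltnW.
Qed.

(** By Bernoulli, [(1 - 1/p)^s >= 1 - t] with [t = s/p <= 1/2], and
    [1 / (1 - t) <= 1 + 2t] on that range. *)
Lemma euler_factor_exp_le p s : (0 < s)%N -> (s.*2 < p)%N ->
  euler_factor p ^+ s <= 1 + s.*2%:R / p%:R.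
Proof.
move=> s0 sp.
have p0 : 0 < p%:R :> F by rewrite ltr0n; lia.
have p1 : 0 < p.-1%:R :> F by rewrite ltr0n; lia.
have h : 1 - s%:R / p%:R <= (euler_factor p)^-1 ^+ s.
  have -> : (euler_factor p)^-1 = 1 + - p%:R^-1.
    rewrite /euler_factor invf_div; have -> : p = p.-1.+1 by lia.
    rewrite -[in RHS]natr1 /=.
    by field; rewrite natr1 pnatr_eq0.
  rewrite -mulrN; apply: bernoulli.
  by rewrite lerN2 invf_le1 // ler1n; lia.
rewrite -[euler_factor p]invrK exprVn.
set t := s%:R / p%:R in h *.
have t0 : 0 <= t by rewrite divr_ge0.
have t1 : t <= 2^-1.
  by rewrite ler_pdivrMr // mulrC ler_pdivlMr // -natrM ler_nat; lia.
have -> : s.*2%:R / p%:R = 2 * t by rewrite -mul2n natrM mulrA.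
rewrite invf_ple ?posrE; [|by lra..].
apply: le_trans h.
rewrite -[leLHS]mul1r ler_pdivrMr; last by lra.
by nra.
Qed.

(** The contribution of one prime: [p] times a bound for the average over the
    residues modulo [p], where [a] is the set of roots. Up to [2s] the
    roots may be all residues. Beyond, there are at most [B] of them and each
    adds at most [2s/p], so the average is at most [1 + 2Bs/p^2], which
    Bernoulli bounds by a power with exponent [2Bs]. *)
Lemma sum_residues_euler_factor_le (a : pred nat) (B p s : nat) :
  (0 < s)%N -> prime p ->
  (count a (index_iota 0 p) <= B)%N ->
  \sum_(0 <= i < p) (if a i then euler_factor p ^+ s else 1)
  <= p%:R * ((if (p <= s.*2)%N then euler_factor p ^+ s else 1)
             * zeta2_factor p ^+ (B * s.*2)).
Proof.
move=> s0 pp cB; have p1 := prime_gt1 pp.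
have p0 : 0 < p%:R :> F by rewrite ltr0n; lia.
have ws1 : 1 <= euler_factor p ^+ s by rewrite exprn_ege1 // euler_factor_ge1.
have us1 : 1 <= zeta2_factor p ^+ (B * s.*2).
  by rewrite exprn_ege1 // zeta2_factor_ge1.
have [ps|sp] := leqP p s.*2.
  apply: (@le_trans _ _ (\sum_(0 <= i < p) euler_factor p ^+ s)).
    by apply: ler_sum => i _; case: ifP.
  rewrite sumr_const_nat subn0 -[leLHS]mulr_natl ler_wpM2l // ler_peMr //.
  exact: le_trans ler01 ws1.
rewrite mul1r.
have -> : \sum_(0 <= i < p) (if a i then euler_factor p ^+ s else 1)
    = p%:R + (count a (index_iota 0 p))%:R * (euler_factor p ^+ s - 1).
  rewrite -sum1_count natr_sum mulr_suml [in RHS]big_mkcond /=.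
  have -> : p%:R = \sum_(0 <= i < p) 1 :> F by rewrite sumr_const_nat subn0.
  rewrite -big_split /=.
  by apply: eq_bigr => i _; case: (a i); rewrite ?mul1r ?addr0 // addrC subrK.
apply: (@le_trans _ _ (p%:R + B%:R * (s.*2%:R / p%:R))).
  rewrite lerD2l; apply: ler_pM; rewrite ?ler_nat ?subr_ge0 //.
  by rewrite lerBlDl euler_factor_exp_le.
apply: (@le_trans _ _ (p%:R * (1 + p%:R ^- 2) ^+ (B * s.*2))); last first.
  rewrite ler_wpM2l // ; apply: lerXn2r; rewrite ?nnegrE ?zeta2_factor_ge //.
    by rewrite addr_ge0 // invr_ge0 exprn_ge0.
  by rewrite (le_trans ler01) // zeta2_factor_ge1.
apply: (@le_trans _ _ (p%:R * (1 + (B * s.*2)%:R * p%:R ^- 2))); last first.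
  rewrite ler_wpM2l // bernoulli // (le_trans (lerN10 _)) //.
  by rewrite invr_ge0 exprn_ge0.
rewrite mulrDr mulr1 lerD2l natrM le_eqVlt; apply/orP; left; apply/eqP.
by field; rewrite gt_eqF.
Qed.

(** * Large and small primes *)

(** The product of the prime divisors exceeding [y] is at most [m], so there are
    at most [y * D] of them, and each Euler factor is at most [1 + 1/y]. *)
Lemma prod_large_euler_factor_le (m y D : nat) : (0 < m)%N -> (0 < y)%N ->
  (m <= y.+1 ^ (y * D))%N ->
  \prod_(p <- primes m | (y < p)%N) euler_factor p <= 4 ^+ D.
Proof.
move=> m0 y0 mD; set r : F := y.+1%:R / y%:R.
have r1 : 1 <= r by rewrite ler_pdivlMr ?mul1r ?ler_nat ?ltr0n.
pose om := count (fun p => y < p)%N (primes m).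
have omD : (om <= y * D)%N.
  rewrite -(@leq_exp2l y.+1) //; apply: leq_trans mD.
  apply: (@leq_trans (\prod_(p <- primes m | y < p) p)%N).
    rewrite -iter_muln_1 -big_const_seq.
    by apply: leq_prod.
  apply: (@leq_trans (\prod_(p <- primes m) p)%N).
    rewrite big_mkcond /= big_seq [leqRHS]big_seq.
    apply: leq_prod => p; rewrite mem_primes => /and3P[pp _ _].
    by case: ifP; rewrite ?prime_gt0.
  rewrite {2}(prod_prime_decomp m0) prime_decompE big_map /=.
  rewrite big_seq [leqRHS]big_seq; apply: leq_prod => p pm.
  rewrite -{1}[p]expn1 leq_pexp2l ?logn_gt0 //.
  by move: pm; rewrite mem_primes => /andP[/prime_gt0].
apply: (@le_trans _ _ (\prod_(p <- primes m | (y < p)%N) r)).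
  apply: ler_prod => p yp; rewrite divr_ge0 //=.
  rewrite /euler_factor /r ler_pdivrMr; last by rewrite ltr0n; lia.
  rewrite mulrAC ler_pdivlMr ?ltr0n // -!natrM ler_nat; nia.
rewrite big_const_seq iter_mulr_1 -/om.
apply: (@le_trans _ _ (r ^+ (y * D))); first exact: ler_weXn2l.
rewrite exprM; apply: lerXn2r; rewrite ?nnegrE ?exprn_ge0 ?divr_ge0 //.
exact: one_plus_inv_exp_le4.
Qed.

Lemma prod_small_euler_factorE (m y s : nat) : (0 < m)%N ->
  (\prod_(p <- primes m | (p <= y)%N) euler_factor p) ^+ s =
  \prod_(p <- primes_upto y) (if (p %| m)%N then euler_factor p ^+ s else 1).
Proof.
move=> m0; rewrite -[RHS]big_mkcond /= -prodrXl -big_filter -[RHS]big_filter.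
apply: perm_big; apply: uniq_perm.
- by rewrite filter_uniq // primes_uniq.
- by rewrite !filter_uniq // iota_uniq.
- move=> p; rewrite mem_filter [RHS]mem_filter mem_primes_upto mem_primes m0 /=.
  by case: (p <= y)%N; case: (prime p); case: (p %| m)%N.
Qed.

(** The summand has period [P], the product of the primes up to [y]. Since
    [P <= y! <= N], the [2N + 1] integers of the range are covered by whole
    periods of total length at most [4N], and the sum over one period factors
    over the primes. *)
Lemma sum_small_primes_le (R : {poly int}) (N y s : nat)
  (B := ((size R).-1 + absz (lead_coef R))%N) :
  R != 0 -> (0 < s)%N -> (0 < N)%N -> (y`! <= N)%N ->
  \sum_(0 <= i < N.*2.+1) \prod_(p <- primes_upto y)
     (if (p %| absz R.[(i%:Z - N%:Z)%R])%N then euler_factor p ^+ s else 1)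
  <= 4 * N%:R * (s.*2%:R ^+ s * 2 ^+ (B * s.*2)).
Proof.
move=> R0 s0 N0 yN.
pose g p i : F :=
  if (p %| absz R.[(i%:Z - N%:Z)%R])%N then euler_factor p ^+ s else 1.
rewrite -/(\sum_(0 <= i < N.*2.+1) \prod_(p <- primes_upto y) g p i).
have prps p : p \in primes_upto y -> prime p.
  by rewrite mem_primes_upto => /andP[].
have ps_gt1 : {in primes_upto y, forall p, (1 < p)%N}.
  by move=> p /prps /prime_gt1.
have ups : uniq (primes_upto y) by rewrite filter_uniq ?iota_uniq.
have w0 p : 0 <= euler_factor p by rewrite divr_ge0.
have g0 p i : 0 <= g p i by rewrite /g; case: ifP => // _; rewrite exprn_ge0.
have gp p i : prime p -> g p (i %% p)%N = g p i.
  by move=> pp; rewrite /g !dvdn_horner_rootE // intr_Fp_mod.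
pose P := (\prod_(p <- primes_upto y) p)%N.
have P0 : (0 < P)%N.
  by rewrite /P big_seq; apply: prodn_cond_gt0 => p /ps_gt1/ltnW.
have PN : (P <= N)%N by apply: leq_trans yN; exact: prod_primes_upto_le.
have Pper i : \prod_(p <- primes_upto y) g p (i %% P)%N
            = \prod_(p <- primes_upto y) g p i.
  apply: eq_big_seq => p pps; rewrite -[LHS]gp ?prps // -[RHS]gp ?prps //.
  by rewrite modn_dvdm // /P (big_rem p pps) /= dvdn_mulr.
pose q := (N.*2.+1 %/ P).+1.
have qP : (q * P <= 4 * N)%N.
  by rewrite /q mulSn; have := leq_trunc_div N.*2.+1 P; lia.
have Lq : (N.*2.+1 <= q * P)%N by rewrite ltnW // ltn_ceil.
apply: le_trans (sum_periodic_le _ Pper Lq) _.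
  by move=> i; rewrite prodr_ge0.
rewrite sum_prod_primes //; last by apply/allP => p /prps.
pose h p := (if (p <= s.*2)%N then euler_factor p ^+ s else 1)
            * zeta2_factor p ^+ (B * s.*2).
have h0 p : 0 <= h p.
  rewrite mulr_ge0 // ?exprn_ge0 // ?divr_ge0 //.
  by case: ifP; rewrite ?exprn_ge0.
apply: (@le_trans _ _ (q%:R * \prod_(p <- primes_upto y) (p%:R * h p))).
  rewrite ler_wpM2l // big_seq [leRHS]big_seq; apply: ler_prod => p pps.
  rewrite sumr_ge0 //=.
  apply: sum_residues_euler_factor_le => //; first exact: prps.
  exact: count_roots_mod_le (prps _ pps) R0.
rewrite big_split /= -natr_prod -/P [leLHS]mulrA -!natrM.
apply: ler_pM => //; rewrite ?prodr_ge0 //.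
  by rewrite ler_nat.
rewrite /h big_split /= -big_mkcond /= !prodrXl.
apply: ler_pM; rewrite ?exprn_ge0 ?prodr_ge0 //.
- by move=> p _; rewrite divr_ge0.
- apply: lerXn2r; rewrite ?nnegrE ?prodr_ge0 //.
  by apply: prod_euler_factor_le => //; rewrite double_gt0.
- apply: lerXn2r; rewrite ?nnegrE ?prodr_ge0 //.
    by move=> p _; rewrite divr_ge0.
  exact: prod_zeta2_factor_le.
Qed.

(** With [A] the sum of the absolute values of the coefficients and [k] the
    degree, [|R(n)| <= A * N^k <= (y+1)^(A + k(y+1))], and
    [A + k(y+1) <= y (A + 2k)] since [y >= 1]. *)
Lemma div_totient_exp_le (R : {poly int}) (N y s : nat) (n : int)
  (D := (\sum_(i < size R) absz (R`_i)%R + (size R).-1.*2)%N) :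
  (0 < N)%N -> (0 < y)%N -> (N <= y.+1`!)%N -> (absz n <= N)%N -> R.[n] != 0 ->
  ((absz R.[n])%:R / (totient (absz R.[n]))%:R : F) ^+ s <=
  4 ^+ (D * s) * \prod_(p <- primes_upto y)
     (if (p %| absz R.[n])%N then euler_factor p ^+ s else 1).
Proof.
move=> N0 y0 Ny nN Rn0; set m := absz R.[n].
have m0 : (0 < m)%N by rewrite absz_gt0.
have w0 p : 0 <= euler_factor p by rewrite divr_ge0.
rewrite div_totientE // (bigID (fun p => p <= y)%N) /= exprMn.
rewrite prod_small_euler_factorE //.
rewrite mulrC ler_wpM2r //.
  by rewrite prodr_ge0 // => p _; case: ifP => // _; rewrite exprn_ge0.
rewrite exprM; apply: lerXn2r; rewrite ?nnegrE ?prodr_ge0 ?exprn_ge0 //.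
under eq_bigl do rewrite -ltnNge.
apply: prod_large_euler_factor_le => //.
apply: leq_trans (horner_absz_le R nN N0) _.
set A := (\sum_(i < _) _)%N in D *; set k := (size R).-1 in D *.
have NE : (N <= y.+1 ^ y.+1)%N by exact: leq_trans Ny (fact_le_exp _).
(* The constant is absorbed by [A <= (y + 1) ^ A]. *)
apply: (@leq_trans (y.+1 ^ A * (y.+1 ^ y.+1) ^ k)%N).
  apply: leq_mul; last by case: (k) => // k'; rewrite leq_exp2r.
  by apply: ltnW; apply: ltn_expl.
rewrite -expnM -expnD leq_pexp2l // /D; nia.
Qed.

End Totient.

(** * The moments *)

Theorem corollary1p1 (K : realType) (k : nat) (k_gt0 : (0 < k)%N)
    (R : {poly int}) (degR : size R = k.+1) :
  exists C : K, 0 < C /\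
    forall (s : nat) (x : K), (0 < s)%N -> 1 <= x ->
      \sum_(n \in [set n : int | - x <= n%:~R <= x /\ R.[n] != 0])
        ((absz R.[n])%:R / (totient (absz R.[n]))%:R : K) ^+ s
      <= C ^+ s * s`!%:R * x.
Proof.
have R0 : R != 0 by rewrite -size_poly_gt0 degR.
pose D := (\sum_(i < size R) absz (R`_i)%R + (size R).-1.*2)%N.
pose B := ((size R).-1 + absz (lead_coef R))%N.
(* The factors come, in order, from the large primes, from [4N], from the two
   factors of [(2s)^s <= 2^s 4^s s!], and from the small primes above [2s]. *)
exists (4 ^+ D * 4 * 2 * 4 * 2 ^+ B.*2); split.
  by rewrite !mulr_gt0 ?exprn_gt0.
move=> s x s0 x1; set N := Num.truncn x.
have x0 : 0 <= x by apply: le_trans x1.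
have N0 : (0 < N)%N by rewrite truncn_gt0.
have Nx : N%:R <= x by rewrite truncn_le.
have [y y0 /andP[yN Ny]] := fact_bracket N0.
rewrite fsbig_finite; last first.
  by apply: sub_finite_set (finite_int_le x) => n [].
(* With the value [0] at the roots of [R], the sum extends to a full interval. *)
pose G n : K := if R.[n] != 0 then
  ((absz R.[n])%:R / (totient (absz R.[n]))%:R) ^+ s else 0.
have G0 n : 0 <= G n.
  by rewrite /G; case: ifP => // _; rewrite exprn_ge0 ?divr_ge0.
set A := [set n : int | _].
have finA : finite_set A.
  by apply: sub_finite_set (finite_int_le x) => n [].
have memA n : n \in fset_set A -> (absz n <= N)%N /\ R.[n] != 0.
  rewrite in_fset_set // inE => -[+ Rn]; rewrite -ler_norml => nx; split=> //.
  by rewrite truncn_ge_nat // natr_absz ?intr_norm.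
rewrite (eq_big_seq G); last first.
  by move=> n /memA[_ Rn]; rewrite /G Rn.
pose rng := [seq i%:Z - N%:Z | i <- index_iota 0 N.*2.+1].
apply: le_trans (_ : \sum_(n <- rng) G n <= _).
  apply: ler_sum_sub => [||//]; first exact: fset_uniq.
  move=> n /memA[nN _].
  apply/mapP; exists (absz (n + N%:Z)); last by lia.
  by rewrite mem_index_iota; lia.
rewrite big_map.
apply: le_trans (_ : 4 ^+ (D * s)
   * \sum_(0 <= i < N.*2.+1) \prod_(p <- primes_upto y)
     (if (p %| absz R.[(i%:Z - N%:Z)%R])%N then euler_factor K p ^+ s else 1)
   <= _).
  rewrite mulr_sumr big_seq [leRHS]big_seq; apply: ler_sum => i.
  rewrite mem_index_iota => /andP[_ iN]; rewrite /G; case: ifPn => [Rn|_].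
    apply: (@div_totient_exp_le _ R N) => //; first exact: ltnW.
    lia.
  rewrite mulr_ge0 ?exprn_ge0 ?prodr_ge0 // => p _.
  by case: ifP => // _; rewrite exprn_ge0 ?divr_ge0.
apply: le_trans (ler_wpM2l _ (sum_small_primes_le K R0 s0 N0 yN)) _.
  by rewrite exprn_ge0.
rewrite -/B !exprMn -!exprM -mul2n natrM exprMn.
rewrite [(B * _)%N](_ : _ = B.*2 * s)%N; last by lia.
have e1 : 4 <= 4 ^+ s :> K.
  by rewrite -[leLHS]expr1; apply: ler_weXn2l => //; lra.
have e2 := exp_self_le_fact K s.
set a := 4 ^+ (D * s); set b := 2 ^+ (_ * s); set c := 2 ^+ s.
have a0 : 0 <= a by rewrite exprn_ge0.
have b0 : 0 <= b by rewrite exprn_ge0.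
have c0 : 0 <= c by rewrite exprn_ge0.
have -> : a * (4 * N%:R * (c * s%:R ^+ s * b)) =
  (a * b * c) * (4 * s%:R ^+ s * N%:R) by ring.
have -> : a * 4 ^+ s * c * 4 ^+ s * b * s`!%:R * x =
  (a * b * c) * (4 ^+ s * (4 ^+ s * s`!%:R) * x) by ring.
rewrite ler_wpM2l ?mulr_ge0 //.
by rewrite !ler_pM ?mulr_ge0 ?exprn_ge0.
Qed.
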